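(* Let $n\ge 2$ and let $g=(w^{(1)},w^{(2)},\ldots,w^{(n)})$ be an element of $G_n$. Then $g\in K_n$ if and only if $w^{(i)}_{a_j}=w^{(j)}_{a_i}$ for all $i,j=1,\ldots,n$ with $i\ne j$. In particular, the membership problem for $K_n$ in $G_n$ is solvable for all $n\ge 2$. Moreover, $K_n$ is undistorted in $G_n$ for all $n\ge 2$.
   Context: Let $FG(a_1,\ldots,a_n)$ be the free group with free basis $\{a_1,\ldots,a_n\}$. For an element $y$ of a free group on a subset of $\{a_1,\ldots,a_n\}$, $y_{a_i}$ denotes the element obtained from $y$ by deleting all occurrences of $a_i$ and $a_i^{-1}$ (i.e. the image of $y$ under the homomorphism sending $a_i$ to $1$ and fixing the other generators). Put $$G_n=FG(a_2,\ldots,a_n)\times FG(a_1,a_3,\ldots,a_n)\times\cdots\times FG(a_1,\ldots,a_{n-1}),$$ where the $i$-th factor is the free group on $\{a_1,\ldots,a_n\}\setminus\{a_i\}$ and all these are regarded as subgroups of $FG(a_1,\ldots,a_n)$. The eraser morphism is the homomorphism $\epsilon:FG(a_1,\ldots,a_n)\to G_n$, $x\mapsto (x_{a_1},\ldots,x_{a_n})$, and $K_n\le G_n$ is its image. The membership problem for a subset $L$ of a finitely generated monoid (or group) $M$ asks for an algorithm that, given an element $g\in M$ (as a word in the generators), decides whether $g\in L$. A (finitely generated) subgroup $H$ of a finitely generated group $G$ is undistorted if there exist $C>0$ and finite generating sets $X$ of $G$ and $Y$ of $H$ such that $|h|_Y\le C|h|_X$ for every $h\in H$, where $|\cdot|_X,|\cdot|_Y$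 denote word lengths with respect to $X$ and $Y$. *)

(* Defs.v *)
From HB Require Import structures.
From mathcomp Require Import all_boot all_order all_algebra.
From mathcomp Require Import boolp classical_sets reals.

Set Implicit Arguments.
Unset Strict Implicit.
Unset Printing Implicit Defensive.

Import Order.TTheory GRing.Theory Num.Theory.

Local Open Scope classical_set_scope.
Local Open Scope group_scope.

(* Elements of a free group are represented by their reduced words.  The
   letter [(a, false)] stands for [a] and [(a, true)] for [a^-1]. *)

Section ReducedWords.
Variable A : eqType.
Implicit Types (x y : A * bool) (s t : seq (A * bool)).

Definition inv_letter x : A * bool := (x.1, ~~ x.2).

Definition reduced s : bool := sorted [rel x y | y != inv_letter x] s.

(* Left multiplication of a reduced word by a letter. *)
Definition reduce_cons x s :=
  if s is y :: s' then if y == inv_letter x then s' else x :: s else [:: x].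

Definition reduce s := foldr reduce_cons [::] s.

Definition inv_word s := rev (map inv_letter s).

Lemma inv_letterK : involutive inv_letter.
Proof. by case=> a b; rewrite /inv_letter /= negbK. Qed.

Lemma reduced_reduce_cons x s : reduced s -> reduced (reduce_cons x s).
Proof.
case: s => [//|y s] /= ys; case: ifP => [_|/negbT yx] /=; last by rewrite yx.
exact: path_sorted ys.
Qed.

Lemma reduced_foldr s t : reduced t -> reduced (foldr reduce_cons t s).
Proof. by move=> rt; elim: s => //= x s; apply: reduced_reduce_cons. Qed.

Lemma reduced_reduce s : reduced (reduce s).
Proof. exact: reduced_foldr. Qed.

Lemma reduce_id s : reduced s -> reduce s = s.
Proof.
elim: s => [//|x s IHs] xs; rewrite /= IHs; last exact: path_sorted xs.
by case: s xs {IHs} => //= y s /andP[/negPf-> _].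
Qed.

Lemma reduce_consK x s :
  reduced s -> reduce_cons x (reduce_cons (inv_letter x) s) = s.
Proof.
case: s => [_|y s] /=; first by rewrite eqxx.
rewrite inv_letterK; case: eqP => [->|_ _] /=; last by rewrite eqxx.
by case: s => //= z s /andP[/negPf-> _].
Qed.

Lemma foldr_reduce s t :
  reduced t -> foldr reduce_cons t (reduce s) = foldr reduce_cons t s.
Proof.
move=> rt; elim: s => //= x s <-; case: (reduce s) => //= y s'.
by case: eqP => //= ->; rewrite reduce_consK //; apply: reduced_foldr.
Qed.

Lemma reduce_catr s t : reduce (s ++ reduce t) = reduce (s ++ t).
Proof.
by rewrite /reduce !foldr_cat -/(reduce _) reduce_id //; apply: reduced_reduce.
Qed.

Lemma reduce_catl s t : reduce (reduce s ++ t) = reduce (s ++ t).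
Proof.
by rewrite [LHS]foldr_cat [RHS]foldr_cat foldr_reduce //; apply: reduced_reduce.
Qed.

Lemma inv_wordK : involutive inv_word.
Proof.
by move=> s; rewrite /inv_word map_rev revK -map_comp map_id_in // => x _;
   apply: inv_letterK.
Qed.

Lemma reduced_inv_word s : reduced s -> reduced (inv_word s).
Proof.
rewrite /reduced /inv_word rev_sorted sorted_map; apply: sub_sorted => x y /=.
by rewrite (can_eq inv_letterK) eq_sym (can2_eq inv_letterK inv_letterK) => ->.
Qed.

Lemma reduce_inv_wordl s : reduce (inv_word s ++ s) = [::].
Proof.
rewrite /reduce foldr_cat /inv_word; elim: s => //= x s IHs.
rewrite rev_cons -cats1 foldr_cat /= -{2}[x]inv_letterK reduce_consK //.
exact: reduced_reduce.
Qed.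

Lemma reduce_inv_wordr s : reduce (s ++ inv_word s) = [::].
Proof. by rewrite -{1}[s]inv_wordK reduce_inv_wordl. Qed.

Lemma all_reduce (p : pred (A * bool)) s : all p s -> all p (reduce s).
Proof.
elim: s => //= x s IHs /andP[px /IHs]; case: (reduce s) => [|y s'] /=.
  by rewrite px.
by case: ifP => _ /= /andP[py ps']; rewrite ?px ?py.
Qed.

Lemma reduce_filter_reduce (a : A) s :
  reduce [seq x <- reduce s | x.1 != a] = reduce [seq x <- s | x.1 != a].
Proof.
elim: s => //= x s IHs; transitivity (reduce [seq y <- x :: reduce s | y.1 != a]).
  case: (reduce s) => //= y s'; case: eqP => //= ->.
  case: (x.1 != a) => //=; rewrite reduce_consK //; exact: reduced_reduce.
by rewrite /=; case: ifP => //= _; rewrite IHs.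
Qed.

End ReducedWords.

Record free_group (A : choiceType) := FreeGroup {
  letters : seq (A * bool);
  letters_reduced : reduced letters
}.

Section FreeGroup.
Variable A : choiceType.
Implicit Types (x y z : free_group A).

HB.instance Definition _ := [isSub for @letters A].
HB.instance Definition _ := [Choice of free_group A by <:].

Definition fg_of_word (s : seq (A * bool)) : free_group A :=
  FreeGroup (reduced_reduce s).

Definition fg_one : free_group A := FreeGroup (isT : reduced [::]).
Definition fg_mul x y := fg_of_word (letters x ++ letters y).
Definition fg_inv x := FreeGroup (reduced_inv_word (letters_reduced x)).

Fact fg_mulA : associative fg_mul.
Proof. by move=> x y z; apply: val_inj; rewrite /= reduce_catr reduce_catl catA. Qed.

Fact fg_mul1 : left_id fg_one fg_mul.
Proof. by case=> s rs; apply: val_inj; apply: reduce_id. Qed.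

Fact fg_mulr1 : right_id fg_one fg_mul.
Proof. by case=> s rs; apply: val_inj; rewrite /= cats0; apply: reduce_id. Qed.

Fact fg_mulV : left_inverse fg_one fg_inv fg_mul.
Proof. by move=> x; apply: val_inj; apply: reduce_inv_wordl. Qed.

Fact fg_mulrV : right_inverse fg_one fg_inv fg_mul.
Proof. by move=> x; apply: val_inj; apply: reduce_inv_wordr. Qed.

HB.instance Definition _ :=
  isGroup.Build (free_group A) fg_mulA fg_mul1 fg_mulr1 fg_mulV fg_mulrV.

(* [erase a y] is the element written [y_a]. *)
Definition erase (a : A) y : free_group A :=
  fg_of_word [seq l <- letters y | l.1 != a].

Fact erase_is_multiplicative a : {morph erase a : x y / x * y}.
Proof.
move=> x y; apply: val_inj.
by rewrite /= reduce_filter_reduce filter_cat reduce_catl reduce_catr.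
Qed.

HB.instance Definition _ a :=
  isMultiplicative.Build (free_group A) (free_group A) (erase a)
    (@erase_is_multiplicative a).

(* Membership in the subgroup freely generated by the letters other than [a]. *)
Definition avoids (a : A) y : bool := all (fun l => l.1 != a) (letters y).

Lemma avoids1 a : avoids a 1.
Proof. by []. Qed.

Lemma avoidsM a x y : avoids a x -> avoids a y -> avoids a (x * y).
Proof. by move=> ax ay; rewrite /avoids /= all_reduce // all_cat; apply/andP. Qed.

Lemma avoidsV a x : avoids a x -> avoids a x^-1.
Proof. by rewrite /avoids /= all_rev all_map. Qed.

Lemma avoids_erase a x : avoids a (erase a x).
Proof. by apply: all_reduce; apply: filter_all. Qed.

End FreeGroup.

(* The generators [a_1, ..., a_n] are indexed by ['I_n].  The factors of [G_n]
   are realised as subgroups of the free group on all [n] generators. *)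

Section Eraser.
Variable n : nat.

Definition in_Gn : pred {ffun 'I_n -> free_group 'I_n} :=
  fun g => [forall i, avoids i (g i)].

Record Gn := MkGn {
  Gn_coord :> {ffun 'I_n -> free_group 'I_n};
  Gn_coordP : in_Gn Gn_coord
}.

HB.instance Definition _ := [isSub for Gn_coord].
HB.instance Definition _ := [Choice of Gn by <:].

Fact in_Gn_group_closed : group_closed in_Gn.
Proof.
split=> [|g h /forallP gP /forallP hP]; apply/forallP=> i; rewrite !ffunE.
  exact: avoids1.
exact: avoidsM (gP i) (avoidsV (hP i)).
Qed.

HB.instance Definition _ :=
  SubChoice_isSubGroup.Build {ffun 'I_n -> free_group 'I_n} in_Gn Gn
    in_Gn_group_closed.

Fact eraserP (x : free_group 'I_n) : in_Gn [ffun i => erase i x].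
Proof. by apply/forallP=> i; rewrite ffunE avoids_erase. Qed.

Definition eraser (x : free_group 'I_n) : Gn := MkGn (eraserP x).

Fact eraser_is_multiplicative : {morph eraser : x y / x * y}.
Proof. by move=> x y; apply/val_inj/ffunP=> i; rewrite !ffunE gmulfM. Qed.

HB.instance Definition _ :=
  isMultiplicative.Build (free_group 'I_n) Gn eraser eraser_is_multiplicative.

Definition Kn : set Gn := range eraser.

End Eraser.

Arguments Kn : clear implicits.

Section Generation.
Variable G : groupType.

(* Finite generating sets are given as families; letters are again signed:
   [(i, true)] stands for the inverse of [X i]. *)
Definition word_value p (X : 'I_p -> G) (w : seq ('I_p * bool)) : G :=
  \prod_(l <- w) (if l.2 then (X l.1)^-1 else X l.1).

(* As the words over [X] spell a subgroup, this makes [H] a subgroup. *)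
Definition generates p (X : 'I_p -> G) (H : set G) : Prop :=
  range (word_value X) = H.

Definition spelled p (X : 'I_p -> G) (g : G) : pred nat :=
  fun k => `[< exists w, size w = k /\ word_value X w = g >].

(* The value [0] for [g] outside the subgroup generated by [X] is junk. *)
Definition word_length p (X : 'I_p -> G) (g : G) : nat :=
  if pselect (exists k, spelled X g k) is left e then ex_minn e else 0.

Definition undistorted (R : realType) (H : set G) : Prop :=
  exists (C : R) (p q : nat) (X : 'I_p -> G) (Y : 'I_q -> G),
    [/\ (0 < C)%R, generates X setT, generates Y H &
        forall h, H h ->
          ((word_length Y h)%:R <= C * (word_length X h)%:R)%R].

End Generation.

(* A machine over the input alphabet [S] has [tm_tapes.+1] two-way infinite
   tapes; the symbols are the blank [None], the letters of [S] and the extra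
   work symbols of [tm_work].  The machine stops in the states where
   [tm_verdict] is defined. *)

Inductive move := MoveLeft | MoveStay | MoveRight.

Record turing_machine (S : finType) := TuringMachine {
  tm_tapes : nat;
  tm_work : finType;
  tm_state : finType;
  tm_start : tm_state;
  tm_verdict : tm_state -> option bool;
  tm_delta : tm_state -> {ffun 'I_tm_tapes.+1 -> option (S + tm_work)} ->
    tm_state * ('I_tm_tapes.+1 -> option (S + tm_work) * move)
}.

Section Tapes.
Variable T : Type.

(* [tape_left] is listed from the head outwards, as is [tape_right]; beyond
   the listed cells everything is blank. *)
Record tape := Tape {
  tape_left : seq (option T);
  tape_head : option T;
  tape_right : seq (option T)
}.

Definition blank_tape : tape := Tape [::] None [::].

Definition tape_of_seq (s : seq T) : tape :=
  if s is x :: s' then Tape [::] (Some x) (map Some s') else blank_tape.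

Definition tape_update (t : tape) (a : option T * move) : tape :=
  let: (x, m) := a in
  let: Tape l _ r := t in
  match m with
  | MoveLeft => Tape (behead l) (head None l) (x :: r)
  | MoveStay => Tape l x r
  | MoveRight => Tape (x :: l) (head None r) (behead r)
  end.

End Tapes.

Section Runs.
Variables (S : finType) (M : turing_machine S).

Definition tm_tape := tape (S + tm_work M).

Definition tm_config := (tm_state M * ('I_(tm_tapes M).+1 -> tm_tape))%type.

Definition tm_step (c : tm_config) : tm_config :=
  if tm_verdict c.1 is Some _ then c else
  let: (q, a) := tm_delta c.1 [ffun i => tape_head (c.2 i)] in
  (q, fun i => tape_update (c.2 i) (a i)).

Definition tm_init (w : seq S) : tm_config :=
  (tm_start M,
   fun i => if i == ord0 then tape_of_seq (map inl w) else blank_tape _).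

Definition tm_decides (L : set (seq S)) : Prop :=
  forall w, exists (k : nat) (b : bool),
    tm_verdict (iter k tm_step (tm_init w)).1 = Some b /\ (b <-> L w).

End Runs.

(* Existence of an algorithm is existence of a Turing machine: under classical
   axioms a mere function [seq _ -> bool] deciding [L] always exists.  The
   notion does not depend on the generating family, which is therefore taken
   to be arbitrary. *)
Definition membership_solvable (G : groupType) (L : set G) : Prop :=
  (exists (p : nat) (X : 'I_p -> G), generates X setT) /\
  forall (p : nat) (X : 'I_p -> G), generates X setT ->
    exists M : turing_machine ('I_p * bool)%type,
      tm_decides M [set w | L (word_value X w)].

(* Main.v *)
(* A compatible family [g] is lifted one coordinate at a time: replacing [x] by
   [x * (erase k x)^-1 * g k] makes coordinate [k] correct, and compatibility
   keeps correct the coordinates that already were.  The length of [x] at most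
   doubles up to an additive [|g k|], so the lift has length at most [2^n] times
   the word length of [g], whence undistortedness.
   Compatibility is decided by a machine with one stack for each pair [(i, j)],
   on which it keeps the reduced word of the inverse of [erase j (g i)] while it
   reads the input; at the end it pops the stacks [(i, j)] and [(j, i)] together. *)
Require Import Defs.
From HB Require Import structures.
From mathcomp Require Import all_boot all_order all_algebra.
From mathcomp Require Import boolp classical_sets reals.
Set Implicit Arguments.
Unset Strict Implicit.
Unset Printing Implicit Defensive.
Local Open Scope group_scope.

(** * Erasing letters and lengths in free groups *)

Section FreeGroupLength.
Variable A : choiceType.
Implicit Types (a b : A) (x y : free_group A) (s : seq (A * bool)).

Fact erase_one a : erase a 1 = 1.
Proof. exact: val_inj. Qed.

HB.instance Definition _ a :=
  Multiplicative_isUMagmaMorphism.Build (free_group A) (free_group A) (erase a)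
    (erase_one a).

(** Reducing before a deletion does not change the reduced result, so both sides reduce the word of
    [x] with both generators deleted at once. *)
Lemma erase_comm a b x : erase a (erase b x) = erase b (erase a x).
Proof.
apply: val_inj; rewrite /= !reduce_filter_reduce -!filter_predI.
by congr reduce; apply: eq_filter => l /=; rewrite andbC.
Qed.

Lemma erase_avoids a x : avoids a x -> erase a x = x.
Proof.
move=> ax; apply: val_inj.
by rewrite /= (all_filterP ax) reduce_id // letters_reduced.
Qed.

Lemma size_reduce s : size (reduce s) <= size s.
Proof.
elim: s => //= x s; case: (reduce s) => //= y t.
by case: ifP => _ //= /ltnW; apply: leqW.
Qed.

Lemma size_letters_mul x y :
  size (letters (x * y)) <= size (letters x) + size (letters y).
Proof. by rewrite -size_cat size_reduce. Qed.

Lemma size_letters_inv x : size (letters x^-1) = size (letters x).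
Proof. by rewrite /= size_rev size_map. Qed.

Lemma size_letters_erase a x : size (letters (erase a x)) <= size (letters x).
Proof. by apply: leq_trans (size_reduce _) _; rewrite size_filter count_size. Qed.

Definition fg_gen a : free_group A := fg_of_word [:: (a, false)].

Lemma fg_gen_letter (l : A * bool) :
  (if l.2 then (fg_gen l.1)^-1 else fg_gen l.1) = fg_of_word [:: l].
Proof. by case: l => a []; apply: val_inj. Qed.

End FreeGroupLength.

(** * Values and lengths of words over a family *)

Section WordValue.
Variable G : groupType.

Lemma word_value_nil p (X : 'I_p -> G) : word_value X [::] = 1.
Proof. exact: big_nil. Qed.

Lemma word_value_cons p (X : 'I_p -> G) l w :
  word_value X (l :: w) = (if l.2 then (X l.1)^-1 else X l.1) * word_value X w.
Proof. exact: big_cons. Qed.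

Lemma word_value_cat p (X : 'I_p -> G) w1 w2 :
  word_value X (w1 ++ w2) = word_value X w1 * word_value X w2.
Proof. exact: big_cat. Qed.

Lemma word_value_map p q (f : 'I_p -> 'I_q) (X : 'I_q -> G) w :
  word_value X [seq (f l.1, l.2) | l <- w] = word_value (X \o f) w.
Proof. by rewrite /word_value big_map. Qed.

Lemma morph_word_value (H : groupType) (f : UMagmaMorphism.type G H) p
    (X : 'I_p -> G) w :
  f (word_value X w) = word_value (f \o X) w.
Proof. by rewrite gmulf_prod; apply: eq_bigr => -[a []] _ //=; rewrite gmulfV. Qed.

(** The element is given by a word, so the junk value of [word_length] is excluded and a shortest
    word exists. *)
Lemma word_length_spelled p (X : 'I_p -> G) w :
  exists2 v, word_value X v = word_value X w &
    size v = word_length X (word_value X w).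
Proof.
rewrite /word_length; case: pselect => [e|[]]; last first.
  by exists (size w); apply/asboolP; exists w.
by case: ex_minnP => k /asboolP[v [<- vw]] _; exists v.
Qed.

Lemma word_length_le p (X : 'I_p -> G) w :
  word_length X (word_value X w) <= size w.
Proof.
rewrite /word_length; case: pselect => // e; case: ex_minnP => k _; apply.
by apply/asboolP; exists w.
Qed.

End WordValue.

Lemma word_value_fg_gen n (x : free_group 'I_n) :
  word_value (@fg_gen _) (letters x) = x.
Proof.
suff sE s : word_value (@fg_gen 'I_n) s = fg_of_word s.
  by apply: val_inj; rewrite sE /= reduce_id // letters_reduced.
elim: s => [|l s IHs]; first by rewrite word_value_nil; apply: val_inj.
rewrite word_value_cons IHs fg_gen_letter; apply: val_inj.
by rewrite /= (reduce_id (reduced_reduce s)).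
Qed.

(** * Finite generating families of $G_n$ and $K_n$ *)

Section GnGenerators.
Variable n : nat.
Implicit Types (i j : 'I_n) (x : free_group 'I_n) (g : Gn n).

Fact eraser_one : eraser (1 : free_group 'I_n) = 1.
Proof. by apply/val_inj/ffunP=> i; rewrite !ffunE gmulf1. Qed.

HB.instance Definition _ :=
  Multiplicative_isUMagmaMorphism.Build (free_group 'I_n) (Gn n) (@eraser n)
    eraser_one.

Lemma GnM g h i : (g * h) i = g i * h i.
Proof. by rewrite /= ffunE. Qed.

Lemma Gn1 i : (1 : Gn n) i = 1.
Proof. by rewrite /= ffunE. Qed.

Lemma GnV g i : g^-1 i = (g i)^-1.
Proof. by apply: (@mulgI _ (g i)); rewrite -GnM !mulgV Gn1. Qed.

Fact factor_subproof i x : in_Gn [ffun t => if t == i then erase i x else 1].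
Proof.
by apply/forallP=> t; rewrite ffunE; case: eqP => [->|_]; rewrite ?avoids_erase.
Qed.

Definition factor i x : Gn n := MkGn (factor_subproof i x).

Lemma factorE i x t : factor i x t = if t == i then erase i x else 1.
Proof. by rewrite ffunE. Qed.

Fact factorM i : {morph factor i : x y / x * y}.
Proof.
move=> x y; apply/val_inj/ffunP=> t; rewrite [RHS]GnM !factorE.
by case: eqP => _; rewrite ?gmulfM ?mulg1.
Qed.

Fact factor1 i : factor i 1 = 1.
Proof.
by apply/val_inj/ffunP=> t; rewrite [RHS]Gn1 factorE gmulf1 if_same.
Qed.

HB.instance Definition _ i :=
  isMultiplicative.Build (free_group 'I_n) (Gn n) (factor i) (factorM i).
HB.instance Definition _ i :=
  Multiplicative_isUMagmaMorphism.Build (free_group 'I_n) (Gn n) (factor i)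
    (factor1 i).

(** All pairs $(i,j)$ serve as indices: [factor] erases $a_i$, so a diagonal pair merely gives the
    identity. *)
Definition Gn_gen (k : 'I_#|{: 'I_n * 'I_n}|) : Gn n :=
  factor (enum_val k).1 (fg_gen (enum_val k).2).

Lemma generates_Gn_gen : generates Gn_gen setT.
Proof.
apply/seteqP; split=> // g _.
(* Induction on a list of coordinates: the word spells [g] on the list and is trivial elsewhere. *)
suff [w wg] : exists w, forall i,
    word_value Gn_gen w i = if i \in enum 'I_n then g i else 1.
  by exists w => //; apply/val_inj/ffunP=> i; rewrite /= wg mem_enum.
elim: (enum 'I_n) (enum_uniq 'I_n) => [_|k r IHr /= /andP[kr /IHr[w wg]]].
  by exists [::] => i; rewrite word_value_nil Gn1.
exists ([seq (enum_rank (k, l.1), l.2) | l <- letters (g k)] ++ w) => i.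
rewrite word_value_cat GnM wg (word_value_map (fun j => enum_rank (k, j))).
have -> : word_value (Gn_gen \o (fun j => enum_rank (k, j))) (letters (g k))
    = factor k (g k).
  rewrite -[in RHS](word_value_fg_gen (g k)) morph_word_value.
  by apply: eq_bigr => l _; rewrite /= /Gn_gen enum_rankK.
rewrite factorE inE; case: eqP => [->|_] /=; last by rewrite mul1g.
by rewrite (negPf kr) mulg1 erase_avoids //; apply: (forallP (Gn_coordP g)).
Qed.

(** Each generator contributes at most one letter to each coordinate; this bounds word length in
    $G_n$ from below. *)
Lemma size_word_value_Gn_gen w i : size (letters (word_value Gn_gen w i)) <= size w.
Proof.
elim: w => [|l w IHw]; first by rewrite word_value_nil Gn1.
rewrite word_value_cons GnM; apply: leq_trans (size_letters_mul _ _) _.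
rewrite /= -add1n; apply: leq_add IHw.
suff gen1 k : size (letters (Gn_gen k i)) <= 1.
  by case: l.2; rewrite ?GnV ?size_letters_inv.
by rewrite factorE; case: eqP => // _; apply: leq_trans (size_letters_erase _ _) _.
Qed.

Lemma generates_Kn : generates (fun j => eraser (fg_gen j)) (Kn n).
Proof.
apply/seteqP; split=> [_ [w _ <-]|_ [x _ <-]].
  by exists (word_value (@fg_gen _) w) => //; rewrite morph_word_value.
by exists (letters x) => //; rewrite -[in RHS](word_value_fg_gen x) morph_word_value.
Qed.

End GnGenerators.


(** * Lifting compatible families; undistortedness *)

Lemma compatible_preimage n (g : Gn n) (L : nat) :
  (forall i j, i != j -> erase j (g i) = erase i (g j)) ->
  (forall i, size (letters (g i)) <= L) ->
  exists2 x, eraser x = g & size (letters x) <= 2 ^ n * L.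
Proof.
move=> gE gL.
have gid i : erase i (g i) = g i.
  by apply: erase_avoids; apply: (forallP (Gn_coordP g)).
have gE' i j : erase j (g i) = erase i (g j).
  by case: (eqVneq i j) => [->|/gE].
(* Adding [L] turns $|x'| \le 2|x| + L$ into $|x'| + L \le 2(|x| + L)$, a clean doubling at each
   coordinate. *)
suff [x xg xL] : exists2 x, {in enum 'I_n, forall i, erase i x = g i} &
    size (letters x) + L <= 2 ^ size (enum 'I_n) * L.
  exists x; last by rewrite size_enum_ord in xL; apply: leq_trans xL; apply: leq_addr.
  by apply/val_inj/ffunP=> i; rewrite ffunE xg ?mem_enum.
elim: (enum 'I_n) => [|k r [x xg xL]] /=; first by exists 1; rewrite ?mul1n.
exists (x * ((erase k x)^-1 * g k)) => [i|].
  rewrite inE !gmulfM gmulfV /=; case: (eqVneq i k) => [-> _|_ ir].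
    rewrite gid [erase k (erase k x)]erase_avoids ?avoids_erase //.
    by rewrite mulgA mulgV mul1g.
  (* For an earlier coordinate [i], the correction is sent to [(erase k (g i))^-1 * erase i (g k)],
     trivial by compatibility. *)
  by rewrite erase_comm xg // gE' mulVg mulg1.
have := size_letters_mul x ((erase k x)^-1 * g k).
have := size_letters_mul (erase k x)^-1 (g k).
have := size_letters_erase k x; have := gL k.
rewrite size_letters_inv expnS -mulnA mul2n -addnn.
move=> h1 h2 h3 h4; apply: leq_trans (leq_add xL xL).
rewrite addnACA addnA leq_add2r.
apply: leq_trans h4 _; rewrite -addnA leq_add2l; apply: leq_trans h3 _.
exact: leq_add.
Qed.

Lemma Kn_compatible n (g : Gn n) :
  Kn n g <-> forall i j : 'I_n, i != j -> erase j (g i) = erase i (g j).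
Proof.
split=> [[x _ <-] i j _|gE]; first by rewrite !ffunE erase_comm.
have [|x <- _] := @compatible_preimage n g (\max_i size (letters (g i))) gE.
  exact: leq_bigmax.
by exists x.
Qed.

Lemma Kn_undistorted (R : realType) n : undistorted R (Kn n).
Proof.
exists (2 ^ n)%:R%R, _, _, (@Gn_gen n), (fun j => eraser (fg_gen j)).
split; [by rewrite Num.Theory.ltr0n expn_gt0 | exact: generates_Gn_gen
  | exact: generates_Kn |].
move=> g gK; rewrite -GRing.natrM Num.Theory.ler_nat.
have [w _ wg] : range (word_value (@Gn_gen n)) g by rewrite generates_Gn_gen.
have [v vg vL] := word_length_spelled (@Gn_gen n) w.
rewrite wg in vg vL.
(* The shortest word [v] bounds every coordinate of [g]; the letters of the lift then spell [g] in
   the generators of $K_n$. *)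
have [i|x xg xL] := compatible_preimage ((Kn_compatible g).1 gK) (L := size v).
  by rewrite -vg size_word_value_Gn_gen.
rewrite -vL; apply: leq_trans xL.
rewrite -xg -[in X in word_length _ X](word_value_fg_gen x).
by rewrite morph_word_value word_length_le.
Qed.

(* A cell beyond the end of a listed half tape is blank, so lists of cells are
   only compared up to trailing blanks. *)
Definition same_cells (T : Type) (u v : seq (option T)) : Prop :=
  forall k, nth None u k = nth None v k.

(** * Half tapes up to trailing blanks, and stacks on them *)

Section Cells.
Variable T : Type.
Implicit Types (u v : seq (option T)) (t : tape T).

Lemma same_cells_head x u v : same_cells (x :: u) v -> x = head None v.
Proof. by move/(_ 0); case: v. Qed.

(** The form [head None u :: behead u] is what [tape_update] leaves when the head moves onto [u]. *)
Lemma same_cells_behead x u v :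
  same_cells (x :: u) v -> same_cells (head None u :: behead u) (behead v).
Proof.
move=> uv k; rewrite nth_behead -uv; case: u {uv} => //=.
by case: k => //= k; rewrite nth_nil.
Qed.

Lemma same_cells_cons x u v : same_cells u v -> same_cells (x :: u) (x :: v).
Proof. by move=> uv []. Qed.

Lemma tape_update_stay t : tape_update t (tape_head t, MoveStay) = t.
Proof. by case: t. Qed.

End Cells.

Section StackTape.
Variables (S : Type) (A : eqType).
Implicit Types (x : A * bool) (o : option (A * bool)) (s : seq (A * bool)).

Definition stack_cells s : seq (option (S + A * bool)) := [seq Some (inr x) | x <- s].

(** The top lies under the head and the rest to its left; cells to the right are arbitrary, since a
    push overwrites them. *)
Definition holds_stack (t : tape (S + A * bool)) s : Prop :=
  same_cells (tape_head t :: tape_left t) (stack_cells s).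

Definition cancels x (h : option (S + A * bool)) : bool :=
  if h is Some (inr y) then y == inv_letter x else false.

(** [reduce_cons] takes two moves: cancel the top or step right to make room, then write the letter
    recorded by [pending_letter], if any. *)
Definition pop_action o (h : option (S + A * bool)) :=
  if o is Some x then if cancels x h then (None, MoveLeft) else (h, MoveRight)
  else (h, MoveStay).

Definition pending_letter o (h : option (S + A * bool)) :=
  if o is Some x then if cancels x h then None else Some x else None.

Definition push_action o (h : option (S + A * bool)) :=
  if o is Some x then (Some (inr x), MoveStay) else (h, MoveStay).

Lemma holds_stack_reduce_cons (t t' : tape (S + A * bool)) o s :
  holds_stack t s -> t' = tape_update t (pop_action o (tape_head t)) ->
  holds_stack
    (tape_update t' (push_action (pending_letter o (tape_head t)) (tape_head t')))
    (if o is Some x then reduce_cons x s else s).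
Proof.
case: o => [x|ts ->]; last by rewrite !tape_update_stay.
case: t => l h r; rewrite /holds_stack /= => ts.
have /= hE := same_cells_head ts; subst h.
case: s ts => [|y s] /= ts -> /=; first exact: same_cells_cons.
case: eqP => _ /=; [exact: same_cells_behead ts | exact: same_cells_cons].
Qed.

End StackTape.

(** * A machine running stacks in parallel and comparing them *)

Section StackMachine.
Variables (S A : finType) (m D : nat).
Variables (ops : S -> 'I_m -> seq (A * bool)) (sigma : 'I_m -> 'I_m).
Hypothesis ops_le : forall a s, size (ops a s) <= D.

Let L : finType := (A * bool)%type.

(* [inl (k, None)] is about to perform the [k]-th operation of the input letter
   under the head; [inl (k, Some f)] has made room above the stacks on which
   the letters [f] are still to be written; [inr None] compares the stacks while
   popping them. *)
Definition stack_state : finType :=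
  (('I_D.+1 * option {ffun 'I_m -> option L}) + option bool)%type.

(** Short lists are padded with idle operations, so all stacks work through the same [D] rounds. *)
Definition stack_op (a : S) (k : nat) (s : 'I_m) : option L :=
  nth None (map Some (ops a s)) k.

Definition on_stacks (h : 'I_m.+1 -> option (S + L))
    (f : 'I_m -> option (S + L) -> option (S + L) * move) (t : 'I_m.+1) :=
  if unlift ord0 t is Some s then f s (h t) else (h t, MoveStay).

Definition stack_delta (q : stack_state)
    (h : {ffun 'I_m.+1 -> option (S + L)}) :
    stack_state * ('I_m.+1 -> option (S + L) * move) :=
  match q with
  | inl (k, None) =>
    if h ord0 is Some (inl a) then
      if k == D :> nat then
        (inl (ord0, None),
         fun t => (h t, if t == ord0 then MoveRight else MoveStay))
      else
        (inl (k, Some [ffun s => pending_letter (stack_op a k s) (h (lift ord0 s))]),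
         on_stacks h (fun s => pop_action (stack_op a k s)))
    else (inr None, fun t => (h t, MoveStay))
  | inl (k, Some f) =>
    (* A run enters this state only with [k < D], so [inord] does not fall back to its default. *)
    (inl (inord k.+1, None), on_stacks h (fun s => push_action (f s)))
  | inr None =>
    if ~~ [forall s, h (lift ord0 s) == h (lift ord0 (sigma s))] then
      (inr (Some false), fun t => (h t, MoveStay))
    else if [forall s, h (lift ord0 s) == None] then
      (inr (Some true), fun t => (h t, MoveStay))
    else (inr None, fun t => (h t, MoveLeft))
  | inr (Some b) => (q, fun t => (h t, MoveStay))
  end.

Definition stack_machine : turing_machine S :=
  @TuringMachine S m L stack_state (inl (ord0, None))
    (fun q => if q is inr v then v else None) stack_delta.

Let M := stack_machine.
Implicit Types (c : tm_config M) (w : seq S) (stk : 'I_m -> seq L).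

Definition stacks_hold c stk : Prop :=
  forall s, holds_stack (c.2 (lift ord0 s)) (stk s).

Definition input_holds c w : Prop :=
  same_cells (tape_head (c.2 ord0) :: tape_right (c.2 ord0)) [seq Some (inl a) | a <- w].

Lemma tm_step_run c : tm_verdict c.1 = None ->
  (tm_step c).1 = (tm_delta c.1 [ffun i => tape_head (c.2 i)]).1 /\
  forall i, (tm_step c).2 i =
    tape_update (c.2 i) ((tm_delta c.1 [ffun i => tape_head (c.2 i)]).2 i).
Proof. by rewrite /tm_step => ->; case: tm_delta. Qed.

Definition stack_push (a : S) (k : nat) stk (s : 'I_m) :=
  if stack_op a k s is Some x then reduce_cons x (stk s) else stk s.

Lemma on_stacks_input c f :
  tape_update (c.2 ord0) (on_stacks [ffun i => tape_head (c.2 i)] f ord0) = c.2 ord0.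
Proof. by rewrite /on_stacks unlift_none ffunE tape_update_stay. Qed.

Lemma on_stacks_stack c f s :
  on_stacks [ffun i => tape_head (c.2 i)] f (lift ord0 s)
  = f s (tape_head (c.2 (lift ord0 s))).
Proof. by rewrite /on_stacks liftK ffunE. Qed.

Lemma stack_op_run c a w stk (k : 'I_D.+1) :
  k < D -> c.1 = inl (k, None) -> input_holds c (a :: w) -> stacks_hold c stk ->
  let c' := iter 2 (@tm_step S M) c in
  [/\ c'.1 = inl (inord k.+1, None), input_holds c' (a :: w)
    & stacks_hold c' (stack_push a k stk)].
Proof.
move=> kD cq cw cs; have ca := same_cells_head cw.
have [|c1q c1t] := @tm_step_run c; first by rewrite cq.
move: c1q c1t; rewrite cq /= ffunE ca /= (ltn_eqF kD) /=.
set c1 := tm_step c => c1q c1t.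
have [|c2q c2t] := @tm_step_run c1; first by rewrite c1q.
move: c2q c2t; rewrite c1q /=; set c2 := tm_step c1 => c2q c2t.
split=> //.
  by rewrite /input_holds c2t on_stacks_input c1t on_stacks_input.
move=> s; rewrite c2t on_stacks_stack !ffunE.
apply: holds_stack_reduce_cons; first exact: cs.
by rewrite c1t on_stacks_stack.
Qed.

(** Induction on the number [j] of remaining rounds, two steps each; one last step advances the
    input head. *)
Lemma stack_ops_run c a w stk j (k : 'I_D.+1) :
  j + k = D -> c.1 = inl (k, None) -> input_holds c (a :: w) -> stacks_hold c stk ->
  exists N, let c' := iter N (@tm_step S M) c in
  [/\ c'.1 = inl (ord0, None), input_holds c' w
    & stacks_hold c' (fun s => foldl (fun u x => reduce_cons x u) (stk s)
        (drop k (ops a s)))].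
Proof.
elim: j c k stk => [|j IHj] c k stk jk cq cw cs.
  have ca := same_cells_head cw; exists 1%N; rewrite /=.
  have [|c1q c1t] := @tm_step_run c; first by rewrite cq.
  move: c1q c1t; rewrite cq /= ffunE ca /= (introT eqP (jk : k = D :> nat)) /= => c1q c1t.
  split=> //.
    rewrite /input_holds c1t ffunE /=; have := same_cells_behead cw.
    by case: (c.2 ord0).
  move=> s; rewrite drop_oversize; last by rewrite (jk : k = D :> nat).
  rewrite c1t ffunE eq_sym (negPf (neq_lift _ _)).
  by have := cs s; case: (c.2 _).
have kD : k < D by apply: leq_trans (eq_leq jk); rewrite addSn ltnS leq_addl.
have [c2q c2w c2s] := stack_op_run kD cq cw cs.
have kE : (inord k.+1 : 'I_D.+1) = k.+1 :> nat by rewrite inordK.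
have [|N [c3q c3w c3s]] := IHj _ _ _ _ c2q c2w c2s.
  by rewrite kE addnS -addSn.
exists (N + 2); rewrite iterD; split=> // s; have := c3s s; rewrite kE.
rewrite /stack_push /stack_op.
case: (ltnP k (size (ops a s))) => ks; last first.
  by rewrite nth_default ?size_map // !drop_oversize // leqW.
by case: (ops a s) ks => // x u ks; rewrite (nth_map x) // (drop_nth x ks).
Qed.

Definition stack_run w (s : 'I_m) : seq L :=
  foldl (fun u x => reduce_cons x u) [::] (flatten [seq ops a s | a <- w]).

Lemma stack_input_run c w stk :
  c.1 = inl (ord0, None) -> input_holds c w -> stacks_hold c stk ->
  exists N, let c' := iter N (@tm_step S M) c in
  c'.1 = inr None /\ stacks_hold c' (fun s =>
    foldl (fun u x => reduce_cons x u) (stk s) (flatten [seq ops a s | a <- w])).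
Proof.
elim: w c stk => [|a w IHw] c stk cq cw cs.
  have ca := same_cells_head cw; exists 1%N; rewrite /=.
  have [|c1q c1t] := @tm_step_run c; first by rewrite cq.
  move: c1q c1t; rewrite cq /= ffunE ca /= => c1q c1t; split=> // s.
  by have := cs s; rewrite /holds_stack c1t ffunE; case: (c.2 _).
have [N1 [c1q c1w c1s]] := stack_ops_run (k := ord0) (addn0 D) cq cw cs.
have [N2 [c2q c2s]] := IHw _ _ c1q c1w c1s.
exists (N2 + N1); rewrite iterD; split=> // s; have := c2s s.
by rewrite drop0 -foldl_cat.
Qed.

(** All stacks are popped at once. An empty stack shows a blank, so unequal heights also appear as a
    mismatch; the bound [N] on the heights gives termination. *)
Lemma stack_compare_run c stk N :
  (forall s, size (stk s) <= N) -> c.1 = inr None -> stacks_hold c stk ->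
  exists k (b : bool), tm_verdict (iter k (@tm_step S M) c).1 = Some b /\
    (b <-> forall s, stk s = stk (sigma s)).
Proof.
elim: N c stk => [|N IHN] c stk stkN cq cs.
all: have hE s : [ffun i => tape_head (c.2 i)] (lift ord0 s) = omap inr (ohead (stk s)) by
  rewrite ffunE (same_cells_head (cs s)); case: (stk s).
all: have [|] := @tm_step_run c; first by rewrite cq.
all: rewrite cq /=; case: ifPn => [/existsP[s]|/negPn/forallP heq].
1,3: rewrite !hE => sneq c1q _; exists 1%N, false; rewrite /= c1q; split=> //.
1,2: by split=> // /(_ s) sE; rewrite -sE eqxx in sneq.
all: case: ifPn => [/forallP hnone|hsome].
1,3: move=> c1q _; exists 1%N, true; rewrite /= c1q; split=> //; split=> // _ s.
1,2: have nil s' : stk s' = [::] by have := hnone s'; rewrite hE; case: (stk s').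
1,2: by rewrite !nil.
  case/negP: hsome; apply/forallP=> s; rewrite hE.
  by have := stkN s; rewrite leqn0 => /nilP->.
move=> c1q c1t.
have [s||s|k [b [kb bE]]] := IHN (tm_step c) (fun s => behead (stk s)).
- by rewrite size_behead -subn1 leq_subLR.
- by rewrite c1q.
- rewrite /holds_stack c1t /stack_cells /= -behead_map.
  by have := same_cells_behead (cs s); case: (c.2 _).
exists k.+1, b; rewrite iterSr; split=> //; rewrite bE.
split=> seq s; last by rewrite seq.
have := heq s; rewrite !hE; have := seq s.
by case: (stk s) (stk (sigma s)) => [|x u] [|y v] //= -> /eqP[->].
Qed.

Lemma stack_machine_decides :
  tm_decides M [set w | forall s, stack_run w s = stack_run w (sigma s)].
Proof.
move=> w.
have [||s|N1 [c1q c1s]] := @stack_input_run (tm_init M w) w (fun=> [::]).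
- by [].
- by rewrite /input_holds /=; case: w => [|a w] /=; [case=> [|[]] | rewrite -map_comp].
- by case=> [|[]].
have [s|k [b [kb bE]]] := stack_compare_run (N := \max_s size (stack_run w s)) _ c1q c1s.
  exact: (leq_bigmax s).
by exists (k + N1)%N, b; rewrite iterD.
Qed.

End StackMachine.

(** * Deciding membership in $K_n$ with stacks *)

Lemma foldr_letters (A : choiceType) (x y : free_group A) :
  foldr (@reduce_cons A) (letters y) (letters x) = letters (x * y).
Proof. by rewrite /= /reduce foldr_cat -/(reduce _) reduce_id // letters_reduced. Qed.

(* The letters of a word are read from left to right while [reduce_cons]
   multiplies on the left, so the stack has to hold the inverse of the product. *)
Lemma foldl_letters_inv (A : choiceType) (I : Type) (f : I -> free_group A)
    (y : free_group A) (w : seq I) :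
  foldl (fun u x => reduce_cons x u) (letters y)
    (flatten [seq rev (letters (f a)^-1) | a <- w])
  = letters ((\prod_(a <- w) f a)^-1 * y).
Proof.
elim: w y => [|a w IHw] y; first by rewrite big_nil invg1 mul1g.
rewrite map_cons [flatten _]/= foldl_cat foldl_rev.
rewrite [foldr _ _ _](foldr_letters (f a)^-1 y) IHw.
by rewrite big_cons invgM mulgA.
Qed.

Lemma Kn_membership_solvable n : membership_solvable (Kn n).
Proof.
split=> [|p X _]; first by exists _, (@Gn_gen n); exact: generates_Gn_gen.
pose val_at (i j : 'I_n) (a : 'I_p * bool) :=
  erase j ((if a.2 then (X a.1)^-1 else X a.1) i).
(* Left multiplication by a word starts with its last letter, hence [rev]. *)
pose ops (a : 'I_p * bool) (s : 'I_#|{: 'I_n * 'I_n}|) :=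
  rev (letters (val_at (enum_val s).1 (enum_val s).2 a)^-1).
pose sigma (s : 'I_#|{: 'I_n * 'I_n}|) :=
  enum_rank ((enum_val s).2, (enum_val s).1).
pose D := \max_a \max_s size (ops a s).
have opsD a s : size (ops a s) <= D.
  by apply: leq_trans (leq_bigmax a); apply: (leq_bigmax s).
have runE w s : stack_run ops w s =
    letters (erase (enum_val s).2 (word_value X w (enum_val s).1))^-1.
  rewrite /stack_run -[[::]]/(letters (1 : free_group 'I_n)) foldl_letters_inv mulg1.
  congr (letters _^-1); rewrite /val_at; move: (enum_val s) => [i j] /=.
  elim: w => [|a w IHw]; first by rewrite word_value_nil big_nil Gn1 gmulf1.
  by rewrite big_cons IHw word_value_cons GnM gmulfM.
exists (stack_machine D ops sigma) => w.
have [k [b [kb bE]]] := @stack_machine_decides _ _ _ D ops sigma opsD w.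
exists k, b; split=> //; apply: (iff_trans bE); apply: iff_sym.
apply: (iff_trans (Kn_compatible _)); split=> [gE s|runs i j _].
  (* A diagonal stack is compared with itself, which imposes no condition. *)
  rewrite !runE /sigma enum_rankK; case: (enum_val s) => i j; congr (letters _^-1).
  by case: (eqVneq i j) => [->|/gE].
have := runs (enum_rank (i, j)); rewrite !runE /sigma !enum_rankK.
by move=> /(@val_inj _ _ (free_group 'I_n) _ _)/invg_inj.
Qed.

Theorem theorem4p4 (R : realType) (n : nat) (hn : (2 <= n)%N) :
  (forall g : Gn n,
     Kn n g <->
     forall i j : 'I_n, i != j -> erase j (g i) = erase i (g j)) /\
  membership_solvable (Kn n) /\
  undistorted R (Kn n).
Proof.
split; first exact: Kn_compatible.
by split; [exact: Kn_membership_solvable | exact: Kn_undistorted].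
Qed.
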